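(* There exist a Borel measure $\mu$ on the hyperbolic plane $\mathbb{H}$ and a constant $c>0$ such that for every $w\in\mathbb{H}$ and every radius $s>0$ one has $\mu(B(w,s))\le c\,s$, and such that the centered maximal operator $M_\mu$ associated to $\mu$ is not of weak type $(1,1)$; that is, there is no constant $C<\infty$ such that $$\mu\{w\in\mathbb{H}: M_\mu f(w)>\lambda\}\le \frac{C}{\lambda}\int_{\mathbb{H}}|f|\,d\mu$$ for all $f\in L^1(\mu)$ and all $\lambda>0$.
   Context: The hyperbolic plane $\mathbb{H}$ is the upper half plane $\{(x,y)\in\mathbb{R}^2: y>0\}$ with its usual topology, equipped with the hyperbolic distance $d$ (the distance of the Riemannian metric $(dx^2+dy^2)/y^2$). For $w\in\mathbb{H}$ and $s>0$, $B(w,s)=\{z\in\mathbb{H}: d(z,w)<s\}$ denotes the hyperbolic ball of center $w$ and radius $s$. For a Borel measure $\mu$ on $\mathbb{H}$, the centered maximal operator associated to $\mu$ is $$M_\mu f(w):=\sup_{s>0}\frac{1}{\mu(B(w,s))}\int_{B(w,s)}|f|\,d\mu .$$ *)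

(* Defs.v *)
From HB Require Import structures.
From mathcomp Require Import all_boot all_order all_algebra.
From mathcomp Require Import all_classical all_reals all_analysis.

Set Implicit Arguments.
Unset Strict Implicit.
Unset Printing Implicit Defensive.

Import Order.TTheory GRing.Theory Num.Theory.
Import numFieldNormedType.Exports.

Local Open Scope classical_set_scope.
Local Open Scope ring_scope.

(* The subset of R * R is turned into a type by the coercion set_type, whose
   canonical topology is the one induced by R * R. *)
Definition hplane (R : realType) : Type := [set z : R * R | 0 < z.2].

HB.instance Definition _ (R : realType) := Topological.copy
  (hplane R) (set_type [set z : R * R | 0 < z.2]).

Lemma hplane_pointP (R : realType) :
  ((0, 1) : R * R) \in [set z : R * R | 0 < z.2].
Proof. by rewrite inE /= ltr01. Qed.

(* Only needed because generated sigma-algebras live on pointed types. *)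
HB.instance Definition _ (R : realType) := isPointed.Build (hplane R)
  (exist _ ((0, 1) : R * R) (hplane_pointP R)).

Definition hplane_borel (R : realType) :=
  g_sigma_algebraType (@open (hplane R)).

Definition C1fun (R : realType) (f : R -> R) : Prop :=
  (forall t, derivable f t 1) /\ continuous (derive1 f).

(* A C^1 curve on [0, 1] is represented by the coordinates of a C^1 extension
   to R, which is constrained to the half plane on [0, 1] only. Zero velocity is
   allowed, so every piecewise C^1 curve is such a curve after a
   reparametrization, which does not change its length. *)
Definition hcurve (R : realType) (z w : hplane R) (x y : R -> R) : Prop :=
  [/\ C1fun x, C1fun y, {in `[0, 1], forall t, 0 < y t},
      (x 0, y 0) = set_val z & (x 1, y 1) = set_val w].

(* Length for the Riemannian metric (dx^2 + dy^2) / y^2. *)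
Definition hlength (R : realType) (x y : R -> R) : R :=
  \int[lebesgue_measure]_(t in `[0, 1])
    (Num.sqrt ((derive1 x t) ^+ 2 + (derive1 y t) ^+ 2) / y t).

(* The set of lengths is nonempty (segments) and bounded below by 0, so that inf
   is its greatest lower bound. *)
Definition hdist (R : realType) (z w : hplane R) : R :=
  inf [set l | exists x y : R -> R, hcurve z w x y /\ l = hlength x y].

Definition hball (R : realType) (w : hplane R) (s : R) : set (hplane R) :=
  [set z | hdist z w < s].

(* Since 0^-1 = +oo and 0 * +oo = 0 in \bar R, a ball of measure 0 contributes
   the average 0. *)
Definition maximal (R : realType)
    (mu : {measure set (hplane_borel R) -> \bar R})
    (f : hplane_borel R -> R) (w : hplane_borel R) : \bar R :=
  ereal_sup
    [set ((mu (hball w s))^-1 * \int[mu]_(z in hball w s) `|f z|%:E)%E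
      | s in [set s : R | 0 < s]].

Definition weak_type11 (R : realType)
    (mu : {measure set (hplane_borel R) -> \bar R})
    (T : (hplane_borel R -> R) -> hplane_borel R -> \bar R) : Prop :=
  exists C : R, forall f : hplane_borel R -> R,
    mu.-integrable setT (EFin \o f) ->
    forall lambda : R, 0 < lambda ->
      (mu [set w | lambda%:E < T f w] <=
         (C / lambda)%:E * \int[mu]_w `|f w|%:E)%E.

(* Main.v *)
Require Import Defs.
From HB Require Import structures.
From mathcomp Require Import all_boot all_order all_algebra.
From mathcomp Require Import all_classical all_reals all_analysis.
From mathcomp Require Import measurable_realfun.
From mathcomp Require Import ring lra.

(* Let w_n = (x_n, h_n) with x_n = exp(-10(n+1)) and h_n = x_n^4. Any two of
   these points are farther from each other than from o = (0, 1), because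
   d(w_i, w_j) is at least log((x_i - x_j)^2 / (h_i h_j)), which exceeds
   d(w_j, o), about log(1/h_j), by an amount of order log(1/x_i) when i < j. A
   measure giving mass 1 to o and to each w_n then has M f >= c at every w_n for
   f the indicator of {o}, on a set of infinite measure. Growth is at most
   linear, since a ball meeting two of the points has radius at least
   proportional to the larger index. As balls of small radius s must have
   measure O(s), point masses are replaced by the length on vertical geodesic
   segments of length 1 starting at w_n, and on the whole ray above o.

   All lower bounds on distances come from the Busemann functions of the
   boundary points (xi, 0), which are 1-Lipschitz, so neither an explicit
   formula nor the triangle inequality for the distance is needed. *)

Import Order.TTheory GRing.Theory Num.Theory.
Import numFieldNormedType.Exports.

Local Open Scope classical_set_scope.
Local Open Scope ring_scope.

(** * Busemann functions along curves *)

(** Up to an additive constant, minus the logarithm of the Poisson kernel with pole [(xi, 0)]. *)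
Definition busemann {R : realType} (xi : R) (z : R * R) : R :=
  ln ((z.1 - xi) ^+ 2 + z.2 ^+ 2) - ln z.2.

Definition dbusemann {R : realType} (xi : R) (x y : R -> R) (t : R) : R :=
  ((x t - xi) ^+ 2 + y t ^+ 2)^-1 *
    (2 * (x t - xi) * derive1 x t + 2 * y t * derive1 y t) -
  (y t)^-1 * derive1 y t.

Lemma C1fun_cvg {R : realType} (f : R -> R) (t : R) :
  C1fun f -> {for t, continuous f}.
Proof.
move=> [df _]; apply: differentiable_continuous.
exact/derivable1_diffP.
Qed.

Lemma is_derive_C1fun {R : realType} (f : R -> R) (t : R) :
  C1fun f -> is_derive t 1 f (derive1 f t).
Proof. by move=> [df _]; rewrite derive1E; apply: DeriveDef. Qed.

Lemma continuous_sqr {R : realType} (f : R -> R) (t : R) :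
  {for t, continuous f} -> {for t, continuous (fun t => f t ^+ 2)}.
Proof.
move=> cf.
apply: (@continuous_comp _ _ _ f (fun u => u ^+ 2)) => //.
exact: exprn_continuous.
Qed.

Lemma speed_continuous {R : realType} (x y : R -> R) (t : R) :
  C1fun x -> C1fun y -> 0 < y t ->
  {for t, continuous
    (fun t => Num.sqrt (derive1 x t ^+ 2 + derive1 y t ^+ 2) / y t)}.
Proof.
move=> cx cy yt; have [_ cdx] := cx; have [_ cdy] := cy.
apply: cvgM; last by apply: cvgV; [rewrite gt_eqF|exact: C1fun_cvg].
apply: (@continuous_comp _ _ _
  (fun t => derive1 x t ^+ 2 + derive1 y t ^+ 2) Num.sqrt);
  last exact: sqrt_continuous.
by apply: cvgD; apply: continuous_sqr; [exact: cdx|exact: cdy].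
Qed.

Lemma is_derive_busemann {R : realType} (xi : R) (x y : R -> R) (t : R) :
  C1fun x -> C1fun y -> 0 < y t ->
  is_derive t 1 (fun t => busemann xi (x t, y t)) (dbusemann xi x y t).
Proof.
move=> cx cy yt.
have dx := is_derive_C1fun _ t cx.
have dy := is_derive_C1fun _ t cy.
have Q0 : 0 < (x t - xi) ^+ 2 + y t ^+ 2.
  by rewrite ltr_wpDl ?sqr_ge0// exprn_gt0.
rewrite /busemann /dbusemann /=; apply: is_deriveB.
  apply: (@is_derive1_comp _ (@ln R) (fun t => (x t - xi) ^+ 2 + y t ^+ 2)).
    exact: is_derive1_ln.
  apply: is_deriveD; apply: is_derive_eq => /=.
  by rewrite subr0 /GRing.scale/=; ring.
  by rewrite /GRing.scale/=; ring.
by apply: (@is_derive1_comp _ (@ln R) y); exact: is_derive1_ln.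
Qed.

Lemma dbusemann_continuous {R : realType} (xi : R) (x y : R -> R) (t : R) :
  C1fun x -> C1fun y -> 0 < y t -> {for t, continuous (dbusemann xi x y)}.
Proof.
move=> cx cy yt; have [_ cdx] := cx; have [_ cdy] := cy.
have xt := C1fun_cvg _ t cx; have ytc := C1fun_cvg _ t cy.
have Q0 : 0 < (x t - xi) ^+ 2 + y t ^+ 2.
  by rewrite ltr_wpDl ?sqr_ge0// exprn_gt0.
have xxt : {for t, continuous (fun t => x t - xi)}.
  by apply: cvgB => //; exact: cvg_cst.
apply: cvgB; last by apply: cvgM; [apply: cvgV; rewrite ?gt_eqF|exact: cdy].
apply: cvgM.
  apply: cvgV; first by rewrite gt_eqF.
  apply: (@cvgD _ _ _ _ _ (fun t => (x t - xi) ^+ 2) (fun t => y t ^+ 2)).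
    exact: (continuous_sqr (fun t => x t - xi)).
  exact: continuous_sqr.
by apply: cvgD; apply: cvgM; rewrite ?cdx ?cdy//;
  [|exact: cdx| |exact: cdy]; apply: cvgM => //; exact: cvg_cst.
Qed.

(* Busemann functions have unit gradient: with X = x - xi,
   (2 X y)^2 + (y^2 - X^2)^2 = (X^2 + y^2)^2, and Cauchy-Schwarz applies. *)
Lemma dbusemann_le_speed {R : realType} (xi : R) (x y : R -> R) (t : R) :
  0 < y t ->
  `|dbusemann xi x y t| <= Num.sqrt (derive1 x t ^+ 2 + derive1 y t ^+ 2) / y t.
Proof.
move=> y0; rewrite /dbusemann.
move: (x t - xi) (y t) (derive1 x t) (derive1 y t) y0 => X Y p q Y0.
have Q0 : 0 < X ^+ 2 + Y ^+ 2 by rewrite ltr_wpDl ?sqr_ge0// exprn_gt0.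
have -> : (X ^+ 2 + Y ^+ 2)^-1 * (2 * X * p + 2 * Y * q) - Y^-1 * q =
    (2 * X * Y * p + (Y ^+ 2 - X ^+ 2) * q) / (X ^+ 2 + Y ^+ 2) / Y.
  by field; rewrite !gt_eqF.
have Yi0 : 0 < Y^-1 by rewrite invr_gt0.
rewrite normrM (gtr0_norm Yi0) ler_pM2r//.
rewrite -(ler_pXn2r (n := 2))// ?nnegrE ?sqrtr_ge0//.
rewrite sqr_sqrtr ?addr_ge0 ?sqr_ge0// real_normK ?num_real//.
rewrite exprMn exprVn ler_pdivrMr ?exprn_gt0//.
rewrite -subr_ge0; set d := (X in 0 <= X).
have -> : d = ((Y ^+ 2 - X ^+ 2) * p - 2 * X * Y * q) ^+ 2 by rewrite /d; ring.
exact: sqr_ge0.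
Qed.

(** The difference is the integral of [dbusemann] over [0, 1], and the speed dominates the
    integrand. Continuity is claimed on [0, 1] only, since [y] may vanish elsewhere. *)
Lemma busemann_le_hlength {R : realType} (xi : R) (z w : hplane R)
    (x y : R -> R) : hcurve z w x y ->
  `|busemann xi (set_val w) - busemann xi (set_val z)| <= hlength x y.
Proof.
move=> [cx cy y0 <- <-].
have ydef t : t \in `[0, 1] -> 0 < y t by exact: y0.
have cG : {within `[0, 1], continuous (dbusemann xi x y)}.
  apply: continuous_in_subspaceT => t; rewrite inE /= => t01.
  by apply: dbusemann_continuous => //; exact: ydef.
have cS : {within `[0, 1], continuous
    (fun t => Num.sqrt (derive1 x t ^+ 2 + derive1 y t ^+ 2) / y t)}.
  apply: continuous_in_subspaceT => t; rewrite inE /= => t01.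
  by apply: speed_continuous => //; exact: ydef.
have cB t : t \in `[0, 1] ->
    {for t, continuous (fun t => busemann xi (x t, y t))}.
  move=> t01; have dB := is_derive_busemann xi x y t cx cy (ydef t t01).
  by apply: differentiable_continuous; exact/derivable1_diffP.
have FTC : \int[lebesgue_measure]_(t in `[0, 1]) dbusemann xi x y t =
    busemann xi (x 1, y 1) - busemann xi (x 0, y 0).
  rewrite /Rintegral (@continuous_FTC2 _ _
    (fun t => busemann xi (x t, y t)))//.
  - split.
    + move=> t t01; have t01' : t \in `[0, 1] by apply: subset_itv_oo_cc.
      by have [] := is_derive_busemann xi x y t cx cy (ydef t t01').
    + by apply: cvg_at_right_filter; apply: cB; rewrite in_itv/= lexx ler01.
    + by apply: cvg_at_left_filter; apply: cB; rewrite in_itv/= lexx ler01.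
  - move=> t t01; have t01' : t \in `[0, 1] by apply: subset_itv_oo_cc.
    rewrite derive1E; apply: derive_val.
    exact: is_derive_busemann (ydef t t01').
rewrite -FTC.
have iG := continuous_compact_integrable (@segment_compact _ 0 1) cG.
have iS := continuous_compact_integrable (@segment_compact _ 0 1) cS.
apply: (le_trans (le_normr_Rintegral _ iG)) => //.
apply: le_Rintegral => //.
  exact: integrable_norm.
by move=> t t01; apply: dbusemann_le_speed; apply: ydef.
Qed.

(** * Explicit curves and bounds on the distance *)

(** One family covers both kinds of curves in use: [c = 0] gives Euclidean segments, [b = 0] arcs of
    exponentially decreasing height. *)
Lemma is_derive_affexp {R : realType} (a b c d t : R) :
  is_derive t 1 (fun t => a + b * t + c * expR (d * t))
    (b + c * d * expR (d * t)).
Proof.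
have dlin (e : R) : is_derive t 1 (fun t => e * t) e.
  by apply: is_derive_eq; rewrite /GRing.scale/= mulr1.
apply: is_deriveD.
  rewrite -[X in is_derive _ _ _ X]add0r.
  by apply: is_deriveD.
have dexp : is_derive t 1 (fun t => expR (d * t)) (expR (d * t) * d).
  by apply: (@is_derive1_comp _ expR (fun t => d * t)).
apply: is_derive_eq; rewrite /GRing.scale/=; ring.
Qed.

Lemma derive1_affexp {R : realType} (a b c d : R) :
  derive1 (fun t => a + b * t + c * expR (d * t)) =
  (fun t => b + c * d * expR (d * t)).
Proof.
apply/funext => t; rewrite derive1E; apply: derive_val.
exact: is_derive_affexp.
Qed.

Lemma C1fun_affexp {R : realType} (a b c d : R) :
  C1fun (fun t => a + b * t + c * expR (d * t)).
Proof.
split=> [t|]; first by have [] := is_derive_affexp a b c d t.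
rewrite derive1_affexp => t.
apply: cvgD; first exact: cvg_cst.
apply: cvgM; first exact: cvg_cst.
apply: (@continuous_comp _ _ _ (fun t => d * t) expR); last first.
  exact: continuous_expR.
by apply: cvgM; [exact: cvg_cst|exact: cvg_id].
Qed.

Lemma hplane_gt0 {R : realType} (z : hplane R) : 0 < (set_val z).2.
Proof. exact: (set_valP z). Qed.

(** The half plane is convex, so a segment works. Lower bounds on [hdist] rely on this, as [inf] of
    the empty set is 0. *)
Lemma hcurve_exists {R : realType} (z w : hplane R) :
  exists x y : R -> R, hcurve z w x y.
Proof.
have z0 := hplane_gt0 z; have w0 := hplane_gt0 w.
case Ez : (set_val z) z0 => [p q] /= q0.
case Ew : (set_val w) w0 => [p' q'] /= q'0.
exists (fun t => p + (p' - p) * t + 0 * expR (0 * t)),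
  (fun t => q + (q' - q) * t + 0 * expR (0 * t)).
split; [exact: C1fun_affexp|exact: C1fun_affexp| | |].
- move=> t; rewrite in_itv/= => /andP[t0 t1]; nra.
- by rewrite !mulr0 !mul0r !addr0 Ez.
- by rewrite !mulr1 !mul0r !addr0 Ew; congr pair; lra.
Qed.

Lemma busemann_le_hdist {R : realType} (xi : R) (z w : hplane R) :
  `|busemann xi (set_val w) - busemann xi (set_val z)| <= hdist z w.
Proof.
apply: lb_le_inf.
  by have [x [y c]] := hcurve_exists z w; exists (hlength x y), x, y.
by move=> _ [x [y [c ->]]]; exact: busemann_le_hlength.
Qed.

Lemma hdist_le_hlength {R : realType} (z w : hplane R) (x y : R -> R) :
  hcurve z w x y -> hdist z w <= hlength x y.
Proof.
move=> c; apply: ge_inf; last by exists x, y.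
(* Any Busemann function shows that lengths are nonnegative. *)
exists 0 => _ [x' [y' [c' ->]]].
exact: le_trans (normr_ge0 _) (busemann_le_hlength 0 _ _ _ _ c').
Qed.

(** * Vertical geodesics, with arc length [r] as coordinate *)

Lemma hpt_subproof {R : realType} (x r : R) :
  (x, expR r) \in [set z : R * R | 0 < z.2].
Proof. by rewrite inE /= expR_gt0. Qed.

Definition hpt {R : realType} (x r : R) : hplane R :=
  exist _ (x, expR r) (hpt_subproof x r).

Lemma busemann_hptxx {R : realType} (x r : R) :
  busemann x (set_val (hpt x r)) = r.
Proof.
rewrite set_valE /busemann /= subrr expr0n /= add0r expRK lnXn ?expR_gt0//.
by rewrite expRK mulr2n addrK.
Qed.

(** The first logarithm in [busemann] is that of the squared Euclidean distance to [(xi, 0)];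
    [expR s] is a lower bound for this distance. *)
Lemma le_busemann_hpt {R : realType} (x r s xi : R) :
  expR s ^+ 2 <= (x - xi) ^+ 2 + expR r ^+ 2 ->
  s + s - r <= busemann xi (set_val (hpt x r)).
Proof.
move=> h; rewrite set_valE /busemann /= expRK lerD2r.
have e0 : 0 < expR s ^+ 2 by rewrite exprn_gt0// expR_gt0.
have -> : s + s = ln (expR s ^+ 2) by rewrite lnXn ?expR_gt0// expRK mulr2n.
by rewrite ler_ln ?posrE// (lt_le_trans e0).
Qed.

(* The curve is an arc of the Euclidean segment between the two points, run so
   that its height decreases exponentially; its speed is then constant. *)
Lemma hdist_hpt_le {R : realType} (X v r : R) :
  0 <= X -> 0 <= v -> r + 1 <= v ->
  hdist (hpt 0 v) (hpt X r) <= (v - r) * (1 + 2 * X).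
Proof.
move=> X0 v0 rv; set rho := v - r.
have rho1 : 1 <= rho by rewrite /rho; lra.
set e := expR (- rho).
have e0 : 0 < e by exact: expR_gt0.
have e2 : e <= 1/2.
  have : 2 <= expR rho by apply: le_trans (expR_ge1Dx rho); lra.
  rewrite /e expRN => h.
  by rewrite div1r lef_pV2 ?posrE ?expR_gt0//; lra.
(* This gives [A * (1 - e) = X], so the arc reaches abscissa [X] at time 1. *)
set A := X / (1 - e).
have A0 : 0 <= A by rewrite divr_ge0//; lra.
have AX : A <= 2 * X.
  rewrite ler_pdivrMr; last lra.
  nra.
have V0 : 0 < expR v by exact: expR_gt0.
have V1 : 1 <= expR v by apply: le_trans (expR_ge1Dx v); lra.
pose x t := A + 0 * t + - A * expR (- rho * t).
pose y t := 0 + 0 * t + expR v * expR (- rho * t).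
have yE t : y t = expR v * expR (- rho * t) by rewrite /y; ring.
have y0 t : 0 < y t by rewrite yE mulr_gt0// expR_gt0.
have c : hcurve (hpt 0 v) (hpt X r) x y.
  split; [exact: C1fun_affexp|exact: C1fun_affexp|by []| |].
  - by rewrite /x /y set_valE/= !mulr0 expR0 !addr0 !mulr1 add0r subrr.
  - rewrite /x /y set_valE/= !mulr1 -/e !addr0 !add0r; congr pair.
      by rewrite /A; field; rewrite gt_eqF//; lra.
    by rewrite /e -expRD; congr expR; rewrite /rho; ring.
apply: le_trans (hdist_le_hlength _ _ _ _ c) _.
have -> : hlength x y =
    \int[lebesgue_measure]_(t in `[(0:R), 1])
       (rho * (Num.sqrt (A ^+ 2 + expR v ^+ 2) / expR v)).
  apply: eq_Rintegral => t _.
  rewrite {1}/x {1}/y !derive1_affexp !add0r yE.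
  set E := expR (- rho * t).
  have E0 : 0 < E by exact: expR_gt0.
  have -> : (- A * - rho * E) ^+ 2 + (expR v * - rho * E) ^+ 2 =
    (rho * E) ^+ 2 * (A ^+ 2 + expR v ^+ 2) by ring.
  rewrite sqrtrM ?sqr_ge0// sqrtr_sqr ger0_norm; last first.
    by rewrite mulr_ge0 ?ltW//; lra.
  by field; rewrite !gt_eqF.
rewrite Rintegral_cst//= lebesgue_measure_itv/= lte_fin ltr01 -EFinB subr0 /=.
rewrite mulr1 ler_pM2l; last lra.
rewrite ler_pdivrMr//.
have -> : (1 + 2 * X) * expR v = `|(1 + 2 * X) * expR v|.
  by rewrite ger0_norm// mulr_ge0 ?ltW//; lra.
rewrite -sqrtr_sqr ler_sqrt ?sqr_ge0//.
have : A <= 2 * X * expR v by apply: le_trans AX _; rewrite ler_peMr//; lra.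
nra.
Qed.

(** * The comb and the measure it carries *)

(* In comb, the negative reals parametrize the ray above o = (0, 1), and
   [n, n + 1) the segment starting at w_n, with x_n = exp(- depth n). *)
Definition depth {R : realType} (n : nat) : R := 10 * n.+1%:R.

Definition tooth {R : realType} (n : nat) (t : R) : hplane R :=
  hpt (expR (- depth n)) (t - n%:R - 4 * depth n).

Definition comb {R : realType} (t : R) : hplane R :=
  if t < 0 then hpt 0 (- t) else tooth (Num.truncn t) t.

Lemma hpt_continuous {R : realType} (x : R) : continuous (hpt x).
Proof.
apply/continuousP => _ [V oV <-].
have cg : continuous (fun r : R => (x, expR r)).
  move=> u; apply: (@cvg_pair _ _ _ _ (nbhs x) (nbhs (expR u)));
    [exact: cvg_cst|exact: continuous_expR].
by move/continuousP : cg; exact.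
Qed.

(** [comb] jumps at the natural numbers but is continuous on each of countably many intervals, so
    preimages of open sets are Borel. *)
Lemma measurable_comb {R : realType} :
  measurable_fun setT (comb : measurableTypeR R -> hplane_borel R).
Proof.
refine (@measurability _ _ (measurableTypeR R) (hplane_borel R) setT comb
  (@open (hplane R)) erefl _).
move=> _ [U oU <-]; rewrite setTI.
have om (g : R -> hplane R) : continuous g -> measurable (g @^-1` U).
  by move=> cg; apply: open_measurable; apply: open_comp => // + _; exact: cg.
have -> : comb @^-1` U =
    (`]-oo, 0%R[ `&` (fun t : R => hpt 0 (- t)) @^-1` U) `|`
    \bigcup_n (`[n%:R, n.+1%:R[ `&` tooth n @^-1` U).
  apply/seteqP; split=> t /=; rewrite /comb.
    have [t0 Ut|t0 Ut] := ltP t 0.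
      by left; split => //; rewrite /= in_itv.
    right; exists (Num.truncn t) => //; split => //=.
    by rewrite in_itv/= truncn_itv.
  case=> [[]|[n _ []]]; rewrite /= in_itv/=.
    by move=> ->.
  move=> /[dup] nt /andP[n0 _].
  have t0 : 0 <= t by apply: le_trans n0.
  by rewrite ltNge t0/= (truncn_def nt).
apply: measurableU.
  apply: measurableI => //; apply: om => t.
  apply: (@continuous_comp _ _ _ (fun t : R => - t) (hpt 0)).
    exact: opp_continuous.
  exact: hpt_continuous.
apply: bigcup_measurable => n _; apply: measurableI => //; apply: om => t.
apply: (@continuous_comp _ _ _ (fun t : R => t - n%:R - 4 * depth n)).
  by apply: cvgB; [apply: cvgB|]; [exact: cvg_id|exact: cvg_cst|exact: cvg_cst].
exact: hpt_continuous.
Qed.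

(** Every piece of [comb] has unit hyperbolic speed, so this is hyperbolic length on the ray and the
    teeth. *)
Definition comb_measure {R : realType} : set (hplane_borel R) -> \bar R :=
  pushforward (@lebesgue_measure R)
    (comb : measurableTypeR R -> hplane_borel R).

Section comb_measure.
Context {R : realType}.

(* Found in the context by the measure structure of pushforward. *)
Let mcomb := @measurable_comb R.

Let comb_measure0 : @comb_measure R set0 = 0%E.
Proof. exact: measure0. Qed.

Let comb_measure_ge0 A : (0 <= @comb_measure R A)%E.
Proof. exact: measure_ge0. Qed.

Let comb_measure_sigma_additive : semi_sigma_additive (@comb_measure R).
Proof. exact: measure_semi_sigma_additive. Qed.

HB.instance Definition _ := isMeasure.Build _ _ _ (@comb_measure R)
  comb_measure0 comb_measure_ge0 comb_measure_sigma_additive.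

End comb_measure.

(* lebesgue_measure is an outer measure on all sets, so hyperbolic balls and
   superlevel sets can be measured without knowing that they are Borel. *)
Lemma le_lebesgue_measure {R : realType} (A B : set R) :
  A `<=` B -> (lebesgue_measure A <= lebesgue_measure B)%E.
Proof.
rewrite /lebesgue_measure /lebesgue_stieltjes_measure /measure_extension.
by move=> AB; exact: (@le_mu_ext _ (ocitv_type R) R (wlength idfun) A B AB).
Qed.

Lemma lebesgue_measure_itv_bounded {R : realType} (b0 b1 : bool) (a b : R) :
  a <= b ->
  lebesgue_measure [set` Interval (BSide b0 a) (BSide b1 b)] = (b - a)%:E.
Proof.
move=> ab; rewrite lebesgue_measure_itv/= lte_fin.
have [//|ba] := ltP a b.
by rewrite (le_anti (introT andP (conj ab ba))) subrr.
Qed.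

(** * Separation of the teeth and linear growth *)

Lemma le_busemann_ray {R : realType} (xi v : R) :
  v <= busemann xi (set_val (hpt 0 v)).
Proof.
rewrite -[leLHS](addrK v); apply: le_busemann_hpt.
by rewrite lerDr sqr_ge0.
Qed.

(** For abscissas of two teeth: the smaller one is at most half the larger, and 1/e is less than the
    other half. *)
Lemma expRN_gap {R : realType} (a b : R) :
  a + 10 <= b -> expR (- a - 1) <= expR (- a) - expR (- b).
Proof.
move=> ab; have a0 : 0 < expR (- a) by exact: expR_gt0.
have h c : 1 <= c -> expR (- a - c) <= expR (- a) / 2.
  move=> c1; rewrite expRD ler_pM2l// expRN lef_pV2 ?posrE ?expR_gt0//.
  by apply: le_trans (expR_ge1Dx c); lra.
have h1 := h 1 (lexx _).
have h2 := h 10 (ler1n _ 10).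
have : expR (- b) <= expR (- a - 10) by rewrite ler_expR; lra.
lra.
Qed.

Lemma comb_tooth {R : realType} (t : R) :
  0 <= t -> comb t = tooth (Num.truncn t) t.
Proof. by rewrite /comb; case: ltP. Qed.

Lemma busemann_comb {R : realType} (t : R) (n := Num.truncn t) : 0 <= t ->
  busemann (expR (- depth n)) (set_val (comb t)) = t - n%:R - 4 * depth n.
Proof. by move=> t0; rewrite comb_tooth// /tooth busemann_hptxx. Qed.

(** Let a < b be the two depths. Over the foot of the earlier tooth, the Busemann function is below
    1 - 4a on that tooth and, by [expRN_gap], above 2(-a - 1) - (1 - 4b) on the later one. *)
Lemma comb_separated {R : realType} (t t' : R) : 0 <= t -> 0 <= t' ->
  (Num.truncn t < Num.truncn t')%N ->
  2 * depth (Num.truncn t) + 4 * depth (Num.truncn t') - 4 <=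
  busemann (expR (- depth (Num.truncn t))) (set_val (comb t')) -
  busemann (expR (- depth (Num.truncn t))) (set_val (comb t)).
Proof.
move=> t0 t'0; rewrite busemann_comb// (comb_tooth t')//.
have /andP[] := truncn_itv t0; have /andP[] := truncn_itv t'0.
move: (Num.truncn t) (Num.truncn t') => i j; rewrite -(natr1 i) -(natr1 j).
move=> jt' t'j it ti ij.
set a := depth i; set b := depth j; rewrite /tooth.
have ab : a + 10 <= b.
  have : i%:R + 1 <= j%:R :> R by rewrite natr1 ler_nat.
  by rewrite /a /b /depth -!natr1; lra.
have gap := expRN_gap a b ab; have g0 := expR_gt0 (- a - 1).
suff : (- a - 1) + (- a - 1) - (t' - j%:R - 4 * b) <=
    busemann (expR (- a)) (set_val (hpt (expR (- b)) (t' - j%:R - 4 * b))).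
  by lra.
apply: le_busemann_hpt.
have := sqr_ge0 (expR (t' - j%:R - 4 * b)).
nra.
Qed.

Lemma truncn_lt_lt {R : realType} (t t' : R) : 0 <= t -> 0 <= t' ->
  (Num.truncn t < Num.truncn t')%N -> t < t'.
Proof.
move=> t0 t'0 ij; have /andP[_ ti] := truncn_itv t0.
have /andP[jt' _] := truncn_itv t'0.
by apply: (lt_le_trans ti); apply: le_trans jt'; rewrite ler_nat.
Qed.

(** Both Busemann values are within [s] of the value at [w], so the gap of [comb_separated] is below
    2s; with j the integer part of [t'], it also exceeds 2(j + 1) > 2t'. *)
Lemma comb_hball_lt {R : realType} (t t' s : R) (w : hplane R) :
  0 <= t -> 0 <= t' -> (Num.truncn t < Num.truncn t')%N ->
  hdist (comb t) w < s -> hdist (comb t') w < s -> t' <= s.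
Proof.
move=> t0 t'0 tt' d d'; have := comb_separated _ _ t0 t'0 tt'.
set xi := expR _.
have := le_lt_trans (busemann_le_hdist xi _ _) d.
have := le_lt_trans (busemann_le_hdist xi _ _) d'.
rewrite !ltr_norml => /andP[l1 l2] /andP[l3 l4].
have /andP[_] := truncn_itv t'0.
rewrite /depth -!natr1 => tj.
have := ler0n R (Num.truncn t); lra.
Qed.

Lemma comb_hball_le {R : realType} (t t' s : R) (w : hplane R) :
  0 <= t -> 0 <= t' -> Num.truncn t != Num.truncn t' ->
  hdist (comb t) w < s -> hdist (comb t') w < s -> t <= s.
Proof.
move=> t0 t'0; rewrite neq_ltn => /orP[tt'|tt'] d d'.
  apply: le_trans (comb_hball_lt _ _ _ _ t0 t'0 tt' d d').
  exact/ltW/truncn_lt_lt.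
exact: comb_hball_lt t'0 t0 tt' d' d.
Qed.

(** The ray and one chosen tooth that meets the ball each give an interval of length 2s, by a
    Busemann function that is affine there. Every other tooth lies in parameters at most [s] by
    [comb_hball_le]. The total is 5s. *)
Lemma comb_preimage_hball {R : realType} (w : hplane R) (s : R) :
  exists a b : R, comb @^-1` hball w s `<=`
    (`]a - s, a + s[ `|` `]b - s, b + s[) `|` `[0, s].
Proof.
exists (- busemann 0 (set_val w)).
have ray t : t < 0 -> hdist (comb t) w < s ->
    t \in `](- busemann 0 (set_val w) - s), (- busemann 0 (set_val w) + s)[.
  move=> t0; rewrite /comb t0 => /(le_lt_trans (busemann_le_hdist 0 _ _)).
  by rewrite busemann_hptxx ltr_norml in_itv/= => /andP[? ?]; lra.
have [[t0 [t00 h0]]|nohit] :=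
    pselect (exists t0 : R, 0 <= t0 /\ hdist (comb t0) w < s).
  pose n := Num.truncn t0.
  exists (busemann (expR (- depth n)) (set_val w) + n%:R + 4 * depth n).
  move=> t /= ht; have [tlt0|tge0] := ltP t 0; first by left; left; exact: ray.
  have [tn|tn] := eqVneq (Num.truncn t) n.
    left; right; rewrite /= in_itv/=.
    have := le_lt_trans (busemann_le_hdist (expR (- depth n)) _ _) ht.
    by rewrite -tn busemann_comb// ltr_norml => /andP[? ?]; lra.
  by right; rewrite /= in_itv/= tge0 (comb_hball_le t t0 s w).
exists 0 => t /= ht; have [tlt0|tge0] := ltP t 0.
  by left; left; exact: ray.
by case: nohit; exists t.
Qed.

Lemma comb_measure_hball {R : realType} (w : hplane R) (s : R) : 0 < s ->
  (comb_measure (hball w s) <= (5 * s)%:E)%E.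
Proof.
move=> s0; rewrite /comb_measure /pushforward.
have [a [b sub]] := comb_preimage_hball w s.
apply: (le_trans (le_lebesgue_measure _ _ sub)).
have ab c : (c - s : R) <= c + s by lra.
apply: le_trans (measureU2 _ _ _) _ => //; first exact: measurableU.
apply: le_trans (leeD2r _ (measureU2 _ _ _)) _ => //.
rewrite /= !lebesgue_measure_itv_bounded ?(ltW s0)// -!EFinD lee_fin; lra.
Qed.

(** * Failure of the weak type inequality *)

(** A unit segment of the ray replaces the point o; as a difference of open sets it is visibly
    Borel. *)
Definition handle {R : realType} : set (hplane R) :=
  [set z | 1 < (set_val z).2 < expR 1] `\` [set z | (set_val z).1 != 0].

Lemma measurable_handle {R : realType} :
  measurable (handle : set (hplane_borel R)).
Proof.
have om (A : set (hplane R)) : open A -> measurable (A : set (hplane_borel R)).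
  by move=> oA; exact: sub_sigma_algebra.
have cv : continuous (set_val : hplane R -> R * R) by exact: initial_continuous.
have c1 : continuous (fun z : hplane R => (set_val z).1).
  by move=> z; apply: (continuous_comp (cv z)); exact: cvg_fst.
have c2 : continuous (fun z : hplane R => (set_val z).2).
  by move=> z; apply: (continuous_comp (cv z)); exact: cvg_snd.
apply: measurableD; apply: om.
  have -> : [set z : hplane R | 1 < (set_val z).2 < expR 1] =
      (fun z : hplane R => (set_val z).2) @^-1` `]1, expR 1[.
    by apply/seteqP; split=> z /=; rewrite in_itv.
  by move/continuousP : c2; apply; exact: interval_open.
have -> : [set z : hplane R | (set_val z).1 != 0] =
    (fun z : hplane R => (set_val z).1) @^-1` [set x | x != 0].
  by [].
by move/continuousP : c1; apply; exact: open_neq.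
Qed.

Lemma handleP {R : realType} (z : hplane R) :
  handle z -> exists2 v : R, 0 < v < 1 & z = hpt 0 v.
Proof.
move=> [/= /andP[z1 ze] /negP]; rewrite negbK => /eqP z0.
exists (ln (set_val z).2).
  rewrite ln_gt0// -[X in _ && (_ < X)]expRK.
  by rewrite ltr_ln ?posrE// ?expR_gt0// (lt_trans _ z1).
apply/val_inj; rewrite /= lnK ?posrE ?(lt_trans _ z1)//.
by rewrite [LHS]surjective_pairing; congr pair.
Qed.

Lemma comb_preimage_handle {R : realType} :
  comb @^-1` handle = [set` `](- 1 : R), 0[].
Proof.
apply/seteqP; split=> t; rewrite /= in_itv/=.
  have [t0|t0] := ltP t 0.
    move=> /handleP[v /andP[v0 v1]].
    rewrite /comb t0 => /(congr1 val) /= [] /expR_inj tv; lra.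
  (* No tooth meets the handle: the Busemann function over its foot is negative on the tooth and at
     least [v > 0] on the handle. *)
  move=> /handleP[v /andP[v0 v1]] /(congr1 (fun z => busemann
    (expR (- depth (Num.truncn t))) (set_val z))).
  rewrite busemann_comb// => E.
  have := le_busemann_ray (expR (- depth (Num.truncn t))) v.
  rewrite -E; have /andP[_] := truncn_itv t0.
  rewrite /depth -!natr1; have := ler0n R (Num.truncn t); lra.
move=> /andP[t1 t0]; rewrite /handle /= /comb t0 set_valE /= eqxx.
split => //; rewrite expR_gt1 ltr_expR; lra.
Qed.

Lemma comb_measure_handle {R : realType} : comb_measure (@handle R) = 1%E.
Proof.
rewrite /comb_measure /pushforward comb_preimage_handle.
by rewrite lebesgue_measure_itv_bounded ?lerN10// opprK add0r.
Qed.

Definition radius {R : realType} (n : nat) : R := 4 * depth n + 12.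

Lemma handle_sub_hball {R : realType} (t : R) : 0 <= t ->
  handle `<=` hball (comb t) (radius (Num.truncn t)).
Proof.
move=> t0 _ /handleP[v /andP[v0 v1] ->].
rewrite /hball /= comb_tooth// /tooth /radius.
have /andP[] := truncn_itv t0; move: (Num.truncn t) => n.
have : 10 <= depth n :> R by rewrite /depth ler_peMr// ler1n.
rewrite -natr1; move: (depth n) => a a10 nt tn.
have X0 := expR_gt0 (- a).
(* The bound is at most (1 + 4a)(1 + 2 exp(-a)), which is at most 4a + 11 because a exp(-a) and
   exp(-a) are at most 1. *)
apply: le_lt_trans (hdist_hpt_le _ _ _ (ltW X0) (ltW v0) _) _; first lra.
have aX : a * expR (- a) <= 1.
  rewrite expRN ler_pdivrMr ?expR_gt0// mul1r.
  by apply: le_trans (expR_ge1Dx a); lra.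
have X1 : expR (- a) <= 1 by rewrite -[leRHS]expR0 ler_expR; lra.
nra.
Qed.

(** Another tooth in the ball would contradict [comb_separated], since depths are at least 10 and
    differ by at least 10. On the ray, Busemann values give -u < 13, so 20 is ample. *)
Lemma comb_preimage_hball_radius {R : realType} (t : R) (n := Num.truncn t) :
  0 <= t ->
  comb @^-1` hball (comb t) (radius n) `<=` `[- 20, 0] `|` `[n%:R, n.+1%:R].
Proof.
move=> t0 u; rewrite /= /hball /= /radius => d.
have n0 := ler0n R n.
have [u0|u0] := ltP u 0.
  left; rewrite in_itv/= (ltW u0) andbT.
  have := le_lt_trans (busemann_le_hdist (expR (- depth n)) _ _) d.
  rewrite busemann_comb// /comb u0 ltr_norml => /andP[+ _].
  have := le_busemann_ray (expR (- depth n)) (- u).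
  by have /andP[_] := truncn_itv t0; rewrite -/n -natr1; lra.
right; suff <- : Num.truncn u = n.
  by rewrite in_itv/=; have /andP[-> /ltW] := truncn_itv u0.
have m0 := ler0n R (Num.truncn u).
have dE k : depth k = 10 * k%:R + 10 :> R by rewrite /depth -natr1; lra.
have [lt|lt|//] := ltngtP (Num.truncn u) n; exfalso.
  have := comb_separated _ _ u0 t0 lt.
  have := le_lt_trans (busemann_le_hdist (expR (- depth (Num.truncn u))) _ _) d.
  rewrite ltr_norml -/n => /andP[l1 l2];
  have := dE n; have := dE (Num.truncn u); lra.
have := comb_separated _ _ t0 u0 lt.
have := le_lt_trans (busemann_le_hdist (expR (- depth n)) _ _) d.
have : n%:R + 1 <= (Num.truncn u)%:R :> R by rewrite natr1 ler_nat.
rewrite ltr_norml -/n => nu /andP[l1 l2];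
have := dE n; have := dE (Num.truncn u); lra.
Qed.

Lemma comb_measure_hball_radius {R : realType} (t : R) : 0 <= t ->
  (comb_measure (hball (comb t) (radius (Num.truncn t))) <= 21%:E)%E.
Proof.
move=> t0; apply: (le_trans (le_lebesgue_measure _ _
  (comb_preimage_hball_radius t t0))).
apply: le_trans (measureU2 _ _ _) _ => //=.
have h20 : - 20 <= 0 :> R by lra.
rewrite !lebesgue_measure_itv_bounded ?ler_nat//.
rewrite -EFinD lee_fin -natr1; lra.
Qed.

Lemma integral_handle {R : realType} (D : set (hplane_borel R)) :
  handle `<=` D ->
  (\int[comb_measure]_(z in D) `|\1_(@handle R) z|%:E = 1)%E.
Proof.
move=> hD.
have abs1 z : `|\1_(@handle R) z| = \1_(@handle R) z :> R.
  by rewrite ger0_norm// indicE ler0n.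
rewrite integral_mkcond.
transitivity (\int[comb_measure]_z (\1_(@handle R) z)%:E)%E.
  apply: eq_integral => z _; rewrite patchE abs1; case: ifPn => // /negP zD.
  by rewrite indicE memNset// => /hD/mem_set.
rewrite integral_indic//; last exact: measurable_handle.
by rewrite setIT; exact: comb_measure_handle.
Qed.

Lemma maximal_comb_gt {R : realType} (t : R) : 0 <= t ->
  ((22^-1)%:E < maximal comb_measure (\1_handle : _ -> R) (comb t))%E.
Proof.
move=> t0; set B := hball (comb t) (radius (Num.truncn t)).
(* The average is at least 1/21; passing to 1/22 makes the inequality strict. *)
apply: (@lt_le_trans _ _ (21^-1)%:E).
  by rewrite lte_fin ltf_pV2 ?posrE// ltr_nat.
apply: (@le_trans _ _ ((comb_measure B)^-1 *
    \int[comb_measure]_(z in B) `|\1_(@handle R) z|%:E)%E).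
  rewrite integral_handle; last exact: handle_sub_hball.
  rewrite mule1.
  have -> : (21^-1)%:E = (21%:E)^-1%E :> \bar R.
    by rewrite inver pnatr_eq0.
  rewrite lee_pV2 ?inE ?lee_fin//.
  exact: comb_measure_hball_radius.
apply: ereal_sup_ubound; exists (radius (Num.truncn t)) => //=.
by rewrite /radius /depth -natr1; have := ler0n R (Num.truncn t); lra.
Qed.

Theorem mainTheorem1 (R : realType) :
  exists (mu : {measure set (hplane_borel R) -> \bar R}) (c : R),
    [/\ 0 < c,
        forall (w : hplane R) (s : R), 0 < s ->
          (mu (hball w s) <= (c * s)%:E)%E
      & ~ weak_type11 mu (maximal mu)].
Proof.
exists comb_measure, 5; split => //; first exact: comb_measure_hball.
move=> [C] /(_ (\1_handle)).
have intO : (@comb_measure R).-integrable setT (EFin \o \1_handle).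
  apply/integrableP; split.
    apply/measurable_EFinP; apply: measurable_indic.
    exact: measurable_handle.
  by rewrite [X in (X < _)%E](integral_handle setT) ?ltry.
move=> /(_ intO 22^-1); rewrite invr_gt0 => /(_ (ltr0n _ 22)).
rewrite integral_handle// mule1.
set E := [set w | _].
(* The right-hand side is now a finite constant, whereas every nonnegative parameter is sent into
   [E]. *)
suff Ey : (+oo <= comb_measure E)%E.
  by move=> /(le_trans Ey); rewrite leye_eq.
have <- : lebesgue_measure (`[0, +oo[ : set R) = +oo%E.
  by rewrite lebesgue_measure_itv/= ltry.
apply: le_lebesgue_measure => t /=; rewrite in_itv/= andbT.
exact: maximal_comb_gt.
Qed.
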